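(* Let $m\ge 2$ and $t\ge 3$ be integers and let $B_m^t$ be the generalized book consisting of $m$ copies of a $t$-cycle with one edge in common. Then $$\mathrm{M}_+^{\mathbb{R}}(B_m^t)=\mathrm{M}_+^{\mathbb{C}}(B_m^t)=\mathrm{Z}_+(B_m^t)=2.$$
   Context: All graphs are finite, simple, undirected, with nonempty vertex set. The generalized book $B_m^t$ is the graph obtained from $m$ disjoint $t$-cycles by choosing one edge in each and identifying all these chosen edges to a single common edge (the cycles share nothing else). For a graph $G$ with vertex set identified with $\{1,\dots,n\}$ and an $n\times n$ Hermitian matrix $A$, the graph $\mathcal{G}(A)$ has vertices $\{1,\dots,n\}$ and edges $\{i,j\}$, $i<j$, exactly when $a_{ij}\neq 0$ (the diagonal is ignored). $\mathrm{M}_+^{\mathbb{R}}(G)$ (resp. $\mathrm{M}_+^{\mathbb{C}}(G)$) is the maximum of $\dim\ker A$ over all real symmetric (resp. complex Hermitian) positive semidefinite $n\times n$ matrices $A$ with $\mathcal{G}(A)=G$. Positive semidefinite color change rule: let $B$ be the set of all currently black vertices of $G$ (all other vertices are white), and let $W_1,\dots,W_k$ be the vertex sets of the connected components of $G-B$ (possibly $k=1$). If $u\in B$, $w\in W_i$, and $w$ is the only white neighbor of $u$ in the induced subgraph $G[W_i\cup B]$, then change the color of $w$ to black. A positive semidefinite zero forcing set is a set $X\subseteq V_G$ such that, starting with exactly the vertices of $X$ black and applying this rule repeatedly (recomputing $B$ and the components each time) until no more changes are possible, all vertices become black. $\mathrm{Z}_+(G)$ is the minimum of $|X|$ over all positive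 semidefinite zero forcing sets $X$. *)

(* Defs.v *)
From HB Require Import structures.
From mathcomp Require Import all_boot all_order all_algebra.
From mathcomp Require Import sesquilinear spectral.
From mathcomp Require Import boolp reals complex.

Set Implicit Arguments.
Unset Strict Implicit.
Unset Printing Implicit Defensive.

Import Order.TTheory GRing.Theory Num.Theory.

Record sgraph := SGraph {
  vertex : finType;
  adj : rel vertex;
  adj_sym : symmetric adj;
  adj_irrefl : irreflexive adj;
  vertex_gt0 : (0 < #|vertex|)%N
}.

Section Book.
Variables m t : nat.

(* The common edge is {inl 0, inl 1}; page i is the t-cycle
   inl 0, inl 1, inr (i, 0), ..., inr (i, t - 3). *)
Definition book_vertex : finType := ('I_2 + 'I_m * 'I_(t - 2))%type.

Definition on_page (i : 'I_m) (x : book_vertex) : bool :=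
  match x with inl _ => true | inr (j, _) => j == i end.

Definition page_pos (x : book_vertex) : nat :=
  match x with inl a => a | inr (_, k) => k.+2 end.

Definition cycle_adj (a b : nat) : bool :=
  (b == a.+1 %% t) || (a == b.+1 %% t).

(* The condition x != y only matters when t < 2. *)
Definition book_adj (x y : book_vertex) : bool :=
  (x != y) && [exists i : 'I_m, [&& on_page i x, on_page i y &
                                   cycle_adj (page_pos x) (page_pos y)]].

Lemma book_adj_sym : symmetric book_adj.
Proof.
move=> x y; rewrite /book_adj eq_sym; congr andb.
by apply: eq_existsb => i; rewrite andbCA /cycle_adj orbC.
Qed.

Lemma book_adj_irrefl : irreflexive book_adj.
Proof. by move=> x; rewrite /book_adj eqxx. Qed.

Lemma book_vertex_gt0 : (0 < #|book_vertex|)%N.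
Proof. by rewrite card_sum card_ord. Qed.

Definition book : sgraph := SGraph book_adj_sym book_adj_irrefl book_vertex_gt0.

End Book.

Section MaximumNullity.
Local Open Scope ring_scope.
Local Open Scope sesquilinear_scope.

(* Vertices are numbered by the enumeration of the vertex type. *)
Definition matrix_graph_is (F : fieldType) (G : sgraph)
    (A : 'M[F]_#|vertex G|) : Prop :=
  forall i j : 'I_#|vertex G|, (i < j)%N ->
    (A i j != 0) = adj (enum_val i) (enum_val j).

Definition real_psd (R : realType) (n : nat) (A : 'M[R]_n) : Prop :=
  A \is symmetricmx /\ forall x : 'cV[R]_n, 0 <= (x^T *m A *m x) 0 0.

(* In R[i], 0 <= z means that z is real and nonnegative. *)
Definition complex_psd (R : realType) (n : nat) (A : 'M[R[i]]_n) : Prop :=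
  A \is hermsymmx /\ forall x : 'cV[R[i]]_n, 0 <= (x^t* *m A *m x) 0 0.

(* The columns of cokermx A span {x | A *m x = 0}. *)
Definition nullity (F : fieldType) (n : nat) (A : 'M[F]_n) : nat :=
  \rank (cokermx A).

Definition max_nullity (F : fieldType) (n : nat) (S : 'M[F]_n -> Prop) : nat :=
  \max_(k < n.+1 | `[< exists2 A, S A & nullity A = k >]) k.

Definition M_plus_real (R : realType) (G : sgraph) : nat :=
  max_nullity (fun A : 'M[R]_#|vertex G| => real_psd A /\ matrix_graph_is A).

Definition M_plus_complex (R : realType) (G : sgraph) : nat :=
  max_nullity
    (fun A : 'M[R[i]]_#|vertex G| => complex_psd A /\ matrix_graph_is A).

End MaximumNullity.

Section ZeroForcing.
Variable G : sgraph.
Implicit Types B W X : {set vertex G}.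

(* Vertex sets of the connected components of G - B. *)
Definition white_components B : {set {set vertex G}} :=
  equivalence_partition
    (connect [rel x y | [&& x \notin B, y \notin B & adj x y]]) (~: B).

Definition white_neighbors B W (u : vertex G) : {set vertex G} :=
  [set v in W :|: B | adj u v & v \notin B].

Definition psd_forces B (u w : vertex G) : bool :=
  (u \in B) &&
  [exists W in white_components B,
     (w \in W) && (white_neighbors B W u == [set w])].

Definition psd_step B B' : bool :=
  [exists u, exists w, psd_forces B u w && (B' == w |: B)].

Definition psd_zero_forcing X : bool := connect psd_step X [set: vertex G].

(* [set: vertex G] is itself forcing, so the default #|vertex G| is harmless. *)
Definition Z_plus : nat :=
  \big[minn/#|vertex G|]_(X : {set vertex G} | psd_zero_forcing X) #|X|.

End ZeroForcing.

(* Main.v *)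
Require Import Defs.
From mathcomp Require Import all_boot all_order all_algebra sesquilinear.
From mathcomp Require Import boolp reals complex ring.
(* A kernel vector of a positive semidefinite matrix A with graph G that vanishes
   on a positive semidefinite zero forcing set X vanishes everywhere, so ker A
   embeds in the functions on X and M_+(G) <= Z_+(G), over R and over C alike.
   For the book, the two endpoints of the common edge force all pages, hence
   Z_+ <= 2. Conversely, representing the 2 + m(t-2) vertices by real vectors in
   dimension m(t-2) whose nonzero inner products are exactly the adjacencies
   gives a Gram matrix of nullity at least 2, hence M_+ >= 2. *)

Set Implicit Arguments.
Unset Strict Implicit.
Unset Printing Implicit Defensive.
Import Order.TTheory GRing.Theory Num.Theory.
Local Open Scope ring_scope.

(** * Kernels of positive semidefinite matrices and zero forcing sets *)

Section PsdForcing.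
Variables (F : numFieldType) (theta : {rmorphism F -> F}).
Hypothesis theta_id : forall a : F, 0 <= a -> theta a = a.
Hypothesis theta_mul_ge0 : forall a : F, 0 <= theta a * a.

(** Adjoint with respect to [theta], which is the identity over the reals and conjugation over the
    complex numbers, so that one argument serves both fields. *)
Definition adjmx p q (M : 'M[F]_(p, q)) : 'M[F]_(q, p) := map_mx theta M^T.

Definition psdmx n (A : 'M[F]_n) : Prop :=
  A = adjmx A /\ forall x : 'cV[F]_n, 0 <= (adjmx x *m A *m x) 0 0.

Lemma adjmx_mul_self n (y : 'cV[F]_n) :
  (adjmx y *m y) 0 0 = \sum_i theta (y i 0) * y i 0.
Proof. by rewrite mxE; apply: eq_bigr => i _; rewrite !mxE. Qed.

Lemma adjmx_mul_self_eq0 n (y : 'cV[F]_n) : (adjmx y *m y) 0 0 = 0 -> y = 0.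
Proof.
rewrite adjmx_mul_self => /eqP; rewrite psumr_eq0 => [/allP y0|i _]; last exact: theta_mul_ge0.
apply/matrixP => i j; rewrite ord1 mxE.
have := y0 i (mem_index_enum _); rewrite /= mulf_eq0 fmorph_eq0 orbb.
by move/eqP.
Qed.

(** If [A *m x] were nonzero, a short step from [x] in the opposite direction would make the form
    negative, because the linear term dominates the quadratic one. *)
Lemma psdmx_isotropic n (A : 'M[F]_n) (x : 'cV[F]_n) :
  psdmx A -> (adjmx x *m A *m x) 0 0 = 0 -> A *m x = 0.
Proof.
move=> [Aherm Age0] xAx; set y := A *m x.
apply: adjmx_mul_self_eq0; apply/eqP; apply/negPn/negP => d_neq0.
set c := (adjmx y *m A *m y) 0 0; set d := (adjmx y *m y) 0 0 in d_neq0 *.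
have c_ge0 : 0 <= c by exact: Age0.
have d_gt0 : 0 < d.
  by rewrite lt_def d_neq0 /d adjmx_mul_self sumr_ge0.
have c1_gt0 : 0 < c + 1 by rewrite ltr_wpDl.
(* The form at [x - s *: y] is [s ^+ 2 * c - 2 * s * d], negative for this [s]; the added 1 keeps
   the denominator nonzero when [c = 0]. *)
pose s := d / (c + 1).
have s_gt0 : 0 < s by rewrite divr_gt0.
have xA : adjmx x *m A = adjmx y.
  by rewrite {1}Aherm /adjmx /y trmx_mul map_mxM.
have := Age0 (x - s *: y).
have -> : adjmx (x - s *: y) = adjmx x - s *: adjmx y.
  by rewrite /adjmx linearB linearZ /= map_mxB map_mxZ /= theta_id // ltW.
have -> : ((adjmx x - s *: adjmx y) *m A *m (x - s *: y)) 0 0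
          = - (s * d) * ((c + 2) / (c + 1)).
  rewrite !mulmxBl !mulmxBr -!scalemxAl -!scalemxAr.
  rewrite -[adjmx y *m A *m x]mulmxA -/y xA.
  have E (u v w z : 'M[F]_1) : (u - v - (w - z)) 0 0 = u 0 0 - v 0 0 - (w 0 0 - z 0 0).
    by rewrite !mxE.
  have Z (a : F) (u : 'M[F]_1) : (a *: u) 0 0 = a * u 0 0 by rewrite mxE.
  rewrite E !Z -/c -/d -xA xAx /s; field.
  by rewrite gt_eqF.
rewrite mulNr oppr_ge0 lt_geF //.
by rewrite !mulr_gt0 ?invr_gt0 // ltr_wpDl.
Qed.

Section Graph.
Variables (G : sgraph) (A : 'M[F]_#|vertex G|).
Hypotheses (A_psd : psdmx A) (A_graph : matrix_graph_is A).
Implicit Types (i j : 'I_#|vertex G|) (x : 'cV[F]_#|vertex G|).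

Lemma psdmx_entry_neq0 i j :
  i != j -> (A i j != 0) = adj (enum_val i) (enum_val j).
Proof.
rewrite neq_ltn => /orP[ij|ji]; first exact: A_graph.
have -> : A i j = theta (A j i) by rewrite {1}(proj1 A_psd) !mxE.
by rewrite fmorph_eq0 adj_sym; apply: A_graph.
Qed.

Lemma white_component_white (B W : {set vertex G}) v :
  W \in white_components B -> v \in W -> v \notin B.
Proof. by case/imsetP => v0 _ ->; rewrite !inE => /andP[]. Qed.

Lemma white_component_closed (B W : {set vertex G}) u v :
  W \in white_components B -> u \in W -> v \notin B -> adj u v -> v \in W.
Proof.
move=> WB uW vB uv; have uB := white_component_white WB uW.
case/imsetP: WB uW => v0 _ ->; rewrite !inE vB => /andP[_ v0u] /=.
by apply: connect_trans v0u (connect1 _); rewrite /= uB vB.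
Qed.

(* The part of a kernel vector carried by one white component is isotropic for
   [A], hence again a kernel vector; the row of the forcing vertex then has a
   single nonzero term. *)
Lemma kernel_psd_forces (B : {set vertex G}) u w x :
  A *m x = 0 -> (forall v, v \in B -> x (enum_rank v) 0 = 0) ->
  psd_forces B u w -> x (enum_rank w) 0 = 0.
Proof.
move=> Ax0 xB /andP[uB /existsP[W /and3P[WB wW /eqP uW]]].
pose y : 'cV[F]_#|vertex G| :=
  \col_j if enum_val j \in W then x j 0 else 0.
(* A column outside [W] belongs either to a black vertex, where [x] vanishes, or to a white vertex
   of another component, which is not adjacent to [j]. *)
have yW j : enum_val j \in W -> (A *m y) j 0 = 0.
  move=> jW; transitivity ((A *m x) j 0); last by rewrite Ax0 mxE.
  rewrite !mxE; apply: eq_bigr => k _; rewrite mxE; case: ifPn => // kW.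
  have [kB|kB] := boolP (enum_val k \in B).
    by rewrite -(enum_valK k) xB // mulr0.
  have [E|jk] := eqVneq j k; first by rewrite -E jW in kW.
  have /eqP -> : A j k == 0; last by rewrite !mul0r.
  apply: contraNT kW; rewrite psdmx_entry_neq0 //.
  exact: white_component_closed WB jW kB.
have Ay0 : A *m y = 0.
  (* [y] vanishes off [W] and [A *m y] vanishes on [W], so every term of the form is zero. *)
  apply: psdmx_isotropic => //; rewrite -mulmxA mxE big1 // => j _.
  case: (boolP (enum_val j \in W)) => jW; first by rewrite yW // mulr0.
  by rewrite !mxE (negPf jW) rmorph0 mul0r.
have uw : adj u w.
  by have := set11 w; rewrite -uW inE => /andP[_ /andP[]].
have := congr1 (fun M : 'cV[F]__ => M (enum_rank u) 0) Ay0.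
rewrite !mxE (bigD1 (enum_rank w)) //= mxE enum_rankK wW big1 ?addr0.
  move/eqP; rewrite mulf_eq0 => /orP[Auw|/eqP //].
  have /negP[] // : A (enum_rank u) (enum_rank w) != 0.
  rewrite psdmx_entry_neq0 ?enum_rankK //.
  by apply: contraTneq uw => /enum_rank_inj ->; rewrite adj_irrefl.
move=> k kw; rewrite mxE; case: ifPn => kW; last by rewrite mulr0.
have kB := white_component_white WB kW.
have /eqP -> : A (enum_rank u) k == 0; last by rewrite mul0r.
apply: contraNT kw; rewrite psdmx_entry_neq0; last first.
  by apply: contraNneq kB => <-; rewrite enum_rankK.
rewrite enum_rankK => uk; rewrite -(inj_eq enum_val_inj) enum_rankK -in_set1 -uW.
by rewrite !inE kW uk kB.
Qed.

Lemma kernel_psd_zero_forcing (X : {set vertex G}) x :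
  psd_zero_forcing X -> A *m x = 0 ->
  (forall v, v \in X -> x (enum_rank v) 0 = 0) -> x = 0.
Proof.
move=> /connectP[p pX pT] Ax0 xX.
suff xT v : x (enum_rank v) 0 = 0.
  by apply/matrixP => i j; rewrite ord1 mxE -(enum_valK i).
elim: p X pX pT xX => [|B p IHp] X /= => [_ XT|/andP[XB pB] pT] xX.
  by apply: xX; rewrite -XT inE.
apply: IHp pB pT _ => z.
case/existsP: XB => u /existsP[w /andP[uw /eqP ->]].
by rewrite !inE => /orP[/eqP ->|/xX //]; apply: kernel_psd_forces uw.
Qed.

(** Restriction to [X] is injective on the kernel, so the rows of [cokermx A] indexed by [X] span
    its whole row space. *)
Lemma nullity_le_psd_zero_forcing (X : {set vertex G}) :
  psd_zero_forcing X -> (nullity A <= #|X|)%N.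
Proof.
move=> Xforcing; set K := cokermx A.
pose M := rowsub (fun k : 'I_#|X| => enum_rank (enum_val k)) K.
suff KM : (K <= M)%MS by exact: leq_trans (mxrankS KM) (rank_leq_row M).
(* Each column of [K *m cokermx M] is a kernel vector of [A] that vanishes on [X], hence zero. *)
rewrite submxE; apply/eqP/matrixP => i j; rewrite [RHS]mxE.
have -> : (K *m cokermx M) i j = col j (K *m cokermx M) i 0 by rewrite [RHS]mxE.
have -> : col j (K *m cokermx M) = 0; last by rewrite mxE.
apply: (kernel_psd_zero_forcing Xforcing).
  by rewrite colE mulmxA (mulmxA A) mulmx_coker !mul0mx.
move=> v vX; transitivity ((M *m cokermx M) (enum_rank_in vX v) j).
  rewrite [LHS]mxE [LHS]mxE [RHS]mxE; apply: eq_bigr => k _.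
  by rewrite [M _ _]mxE enum_rankK_in.
by rewrite mulmx_coker mxE.
Qed.

End Graph.
End PsdForcing.

(** * Bounds on the extremal parameters *)

Section MaximumNullityForcing.
Variables (F : fieldType) (n : nat) (S : 'M[F]_n -> Prop).

Lemma leq_max_nullity (A : 'M[F]_n) : S A -> (nullity A <= max_nullity S)%N.
Proof.
move=> SA; have An : (nullity A < n.+1)%N by rewrite ltnS rank_leq_row.
rewrite -[leqLHS]/(nat_of_ord (Ordinal An)); apply: leq_bigmax_cond.
by apply/asboolP; exists A.
Qed.

Lemma max_nullity_leq k :
  (forall A, S A -> nullity A <= k)%N -> (max_nullity S <= k)%N.
Proof. by move=> Sk; apply/bigmax_leqP => i /asboolP[A SA <-]; apply: Sk. Qed.

End MaximumNullityForcing.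

Lemma Z_plus_leq (G : sgraph) (X : {set vertex G}) :
  psd_zero_forcing X -> (Z_plus G <= #|X|)%N.
Proof.
move=> XF; rewrite /Z_plus -minEnat.
exact: (@bigmin_le_cond _ nat _ _ _ _ (fun Y : {set vertex G} => #|Y|%N)).
Qed.

Lemma leq_Z_plus (G : sgraph) k :
  (forall X : {set vertex G}, psd_zero_forcing X -> k <= #|X|)%N -> (k <= Z_plus G)%N.
Proof.
move=> Xk; rewrite /Z_plus; apply: (big_ind (fun l => k <= l)%N) => //.
(* The default value of the minimum is the size of the full vertex set, which is forcing by the
   empty chain. *)
- by rewrite -cardsT; apply/Xk/connect0.
- by move=> a b ka kb; rewrite leq_min ka.
Qed.

(** * The real and complex instances of semidefiniteness *)

Section RealComplex.
Variable R : realType.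

Lemma real_psd_psdmx n (A : 'M[R]_n) : real_psd A <-> psdmx idfun A.
Proof.
have E p q (M : 'M[R]_(p, q)) : adjmx idfun M = M^T by rewrite /adjmx map_mx_id.
split=> -[]; rewrite /psdmx ?E.
  move=> /is_hermitianmxP AE A0; split=> [|x]; last by rewrite E.
  by rewrite {1}AE expr0 scale1r map_mx_id.
move=> AE A0; split=> [|x]; last by rewrite -E.
by apply/is_hermitianmxP; rewrite expr0 scale1r map_mx_id.
Qed.

Lemma complex_psd_psdmx n (A : 'M[R[i]]_n) : complex_psd A <-> psdmx Num.conj A.
Proof.
split=> -[].
  move=> /is_hermitianmxP AE A0; split=> [|x]; last exact: A0.
  by rewrite {1}AE expr0 scale1r.
move=> AE A0; split=> [|x]; last exact: A0.
by apply/is_hermitianmxP; rewrite expr0 scale1r.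
Qed.

End RealComplex.

(** * Zero forcing in the generalized book *)

Section BookForcing.
Local Open Scope nat_scope.
Variables m t : nat.
Hypothesis ht : 3 <= t.

Let V := book_vertex m t.

(** Only the successor of [b] can wrap around modulo [t], which yields the edge closing the cycle at
    0. *)
Lemma cycle_adjE a b :
  a < b < t -> cycle_adj t a b = (b == a.+1) || (a == 0) && (b.+1 == t).
Proof.
case/andP=> ab bt; rewrite /cycle_adj (@modn_small a.+1) ?(leq_ltn_trans ab) //.
have [->|bt'] := eqVneq b.+1 t; first by rewrite modnn andbT.
have {bt'}bt : b.+1 < t by rewrite ltn_neqAle bt'.
rewrite andbF orbF modn_small //.
by rewrite (@ltn_eqF a b.+1) ?orbF // ltnW.
Qed.

Lemma page_pos_lt (v : V) : page_pos v < t.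
Proof.
case: v => [a|[i k]] /=; first exact: leq_trans (ltn_ord a) (ltnW ht).
by have := ltn_ord k; rewrite ltn_subRL.
Qed.

(** With both hubs black, every edge between white vertices stays inside one page. *)
Lemma connect_white_page (B : {set V}) (i : 'I_m) (v w : V) :
  (forall a, inl a \in B) -> on_page i v ->
  connect [rel x y | [&& x \notin B, y \notin B & book_adj x y]] v w ->
  on_page i w.
Proof.
move=> hubB iv vw; rewrite -[on_page i w]/(w \in [pred x | on_page i x]).
rewrite -(closed_connect _ vw) // => x y /= /and3P[xB yB /andP[_ /existsP[j]]].
case: x xB => [a|[i1 k1]]; first by rewrite hubB.
case: y yB => [a|[i2 k2]]; first by rewrite hubB.
by move=> _ _ /and3P[/eqP -> /eqP -> _]; rewrite !inE.
Qed.

(* The next vertex of a page is forced by its predecessor on that page, since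
   removing the two hubs separates the pages. *)
Lemma down_closed_forcing (B : {set V}) :
  (forall a, inl a \in B) ->
  (forall i (k l : 'I_(t - 2)), inr (i, k) \in B -> l < k -> inr (i, l) \in B) ->
  @psd_zero_forcing (book m t) B.
Proof.
have [n] := ubnP #|~: B|; elim: n B => // n IHn B Bn hubB downB.
case: (pickP (fun v : V => v \notin B)) => [v0 v0B|allB]; last first.
  suff -> : B = setT by apply: connect0.
  by apply/setP => v; rewrite inE; have /negbFE := allB v.
case: (arg_minnP (P := fun v : V => v \notin B) (@page_pos m t) v0B) => -[a|[i k]] wB wmin.
  by rewrite hubB in wB.
set w : V := inr (i, k) in wB wmin.
(* The predecessor of [w] is black by minimality of [w]; for [k = 0] it is hub 1. *)
have [u [uB ui posu]] : exists u : V, [/\ u \in B, on_page i u & page_pos u = k.+1].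
  case E: (val k) => [|k'].
    by exists (inl (@Ordinal 2 1 isT)).
  have lk : k' < t - 2 by rewrite (leq_trans _ (ltn_ord k)) // E leqW.
  exists (inr (i, Ordinal lk)); split=> //=.
  apply: contraT => /wmin /=.
  by rewrite E ltnn.
have stepB : @psd_step (book m t) B (w |: B).
  apply/existsP; exists u; apply/existsP; exists w; rewrite eqxx andbT.
  rewrite /psd_forces uB /=; apply/existsP.
  exists [set y in ~: B | connect [rel x y | [&& x \notin B, y \notin B & book_adj x y]] w y].
  apply/and3P; split; first by apply: imset_f; rewrite inE.
    by rewrite !inE wB connect0.
  have uneq (v : V) : v \notin B -> u != v by apply: contraNneq => <-.
  have wlt := page_pos_lt w; rewrite /= in wlt.
  apply/eqP/setP => v; rewrite !inE; apply/idP/eqP => [|->]; last first.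
    rewrite wB connect0 /= andbT /book_adj uneq //=; apply/existsP; exists i.
    by rewrite ui /= eqxx posu cycle_adjE ?ltnSn //= eqxx.
  case/and3P => /orP[/andP[vB wv]|->] //; rewrite ?andbF //.
  have iv : on_page i v by apply: connect_white_page hubB _ wv; rewrite /= eqxx.
  case/andP=> _ /existsP[j /and3P[_ jv]] uv _.
  (* Minimality places [v] above [u], and [u] is not at position 0, so adjacency leaves only the
     position of [w]. *)
  have := wmin v vB; have := page_pos_lt v.
  case: v vB iv jv uv {wv} => [a|[i' l]]; first by rewrite hubB.
  move=> _ /= /eqP -> _; rewrite posu => uv lt kl.
  move: uv; rewrite cycle_adjE ?lt ?andbT // orbF !eqSS => /eqP lk.
  by rewrite /w; congr (inr (_, _)); apply: val_inj.
apply: connect_trans (connect1 stepB) _; apply: IHn.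
- rewrite ltnS in Bn; apply: leq_trans (proper_card _) Bn.
  rewrite setCU properEneq subsetIr andbT.
  by apply/eqP => /setP/(_ w); rewrite !inE eqxx wB.
- by move=> a; rewrite !inE hubB orbT.
move=> i1 k1 l; rewrite !inE => /orP[/eqP[-> ->] lk|kB lk].
  apply/orP; right; apply: contraT => /wmin /=.
  by rewrite leqNgt !ltnS lk.
by rewrite (downB _ _ _ kB lk) orbT.
Qed.

Definition hubs : {set V} := [set inl a | a : 'I_2].

Lemma card_hubs : #|hubs| = 2.
Proof. by rewrite card_imset ?card_ord // => a b []. Qed.

Lemma hubs_forcing : @psd_zero_forcing (book m t) hubs.
Proof.
apply: down_closed_forcing => [a|i k l]; first exact: imset_f.
by case/imsetP.
Qed.

End BookForcing.

(** * A Gram matrix with the graph of the book *)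

Section BookGram.
Variables (m t : nat).
Hypotheses (hm : (2 <= m)%N) (ht : (3 <= t)%N).
Variables (F : numFieldType) (theta : {rmorphism F -> F}).
Hypothesis theta_mul_ge0 : forall a : F, 0 <= theta a * a.

Let V := book_vertex m t.

(* With (e_(i,l)) the standard basis, interior vertex k of page i is represented
   by e_(i,k) + e_(i,k+1) (the second term is absent for the last k), hub 1 by
   the sum of the e_(i,0), and hub 0 by the sum of the (-1)^l e_(i,l), which is
   orthogonal to all interior vertices but the last of each page. *)
Definition gram_coord (i : 'I_m) (l : nat) (v : V) : F :=
  match v with
  | inl a => if a == 0%N :> nat then (-1) ^+ l else (l == 0%N)%:R
  | inr (j, k) => (i == j)%:R * ((l == k)%:R + (l == k.+1)%:R)
  end.

(** No conjugation appears: the coordinates are integers, fixed by [theta]. *)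
Definition gram (u v : V) : F :=
  \sum_i \sum_(l < t - 2) gram_coord i l u * gram_coord i l v.

Lemma gramC u v : gram u v = gram v u.
Proof. by apply: eq_bigr => i _; apply: eq_bigr => l _; rewrite mulrC. Qed.

(** The index [k] may be out of range; this is how the second basis vector of the last vertex of a
    page drops out. *)
Lemma sum_ord_delta n (k : nat) (f : nat -> F) :
  \sum_(l < n) (l == k :> nat)%:R * f l = (k < n)%:R * f k.
Proof.
case: ltnP => kn.
  rewrite (bigD1 (Ordinal kn)) //= eqxx big1 ?addr0 // => l lk.
  by rewrite -[k]/(val (Ordinal kn)) val_eqE (negPf lk) mul0r.
rewrite mul0r big1 // => l _.
by rewrite ltn_eqF ?mul0r // (leq_trans (ltn_ord l)).
Qed.

Lemma gram_page i (k : 'I_(t - 2)) v :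
  gram (inr (i, k)) v = gram_coord i k v + (k.+1 < t - 2)%:R * gram_coord i k.+1 v.
Proof.
rewrite /gram (bigD1 i) //= [X in _ + X]big1 ?addr0 => [|j /negPf ji]; last first.
  by apply: big1 => l _; rewrite ji !mul0r.
under eq_bigr do rewrite eqxx mul1r mulrDl.
rewrite big_split /= (sum_ord_delta _ _ (fun l => gram_coord i l v)).
by rewrite (sum_ord_delta _ _ (fun l => gram_coord i l v)) ltn_ord mul1r.
Qed.

(** Hub 1 is supported on the [e_(i,0)], where hub 0 has coordinate 1, so each page contributes
    1. *)
Lemma gram_hubs : gram (inl ord0) (inl ord_max) = m%:R.
Proof.
rewrite /gram -[m in RHS]card_ord -sumr_const; apply: eq_bigr => i _ /=.
under eq_bigr do rewrite mulrC.
by rewrite (sum_ord_delta _ _ (fun l => (-1) ^+ l)) subn_gt0 ht mul1r.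
Qed.

Lemma book_adj_hub_page (a : 'I_2) i (k : 'I_(t - 2)) :
  book_adj (inl a : V) (inr (i, k)) =
  if a == 0%N :> nat then k.+3 == t else k == 0%N :> nat.
Proof.
rewrite /book_adj /=.
transitivity (cycle_adj t a k.+2).
  by apply/existsP/idP => [[j /andP[]]|] //; exists i; rewrite eqxx.
have klt := page_pos_lt ht (inr (i, k) : V); rewrite /= in klt.
rewrite cycle_adjE // ?klt ?andbT; last by rewrite (leq_trans (ltn_ord a)).
by case: a => -[|[|//]] ? /=; rewrite ?orbF.
Qed.

Lemma book_adj_page i j (k l : 'I_(t - 2)) :
  book_adj (inr (i, k) : V) (inr (j, l)) =
  (i == j) && ((l == k.+1 :> nat) || (k == l.+1 :> nat)).
Proof.
wlog kl : i j k l / (k <= l)%N => [W|].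
  case: (leqP k l) => [|/ltnW] /W; first exact.
  by rewrite -/(adj (s := book m t) _ _) /= book_adj_sym => ->; rewrite eq_sym orbC.
rewrite (@ltn_eqF k l.+1) // orbF /book_adj.
case: (eqVneq i j) => [<-|ij] /=; last first.
  apply/andP => -[_ /existsP[p /and3P[/eqP ip /eqP jp _]]].
  by rewrite ip jp eqxx in ij.
have [<-|nkl] := eqVneq k l; first by rewrite eqxx ltn_eqF.
have {}kl : (k < l)%N by rewrite ltn_neqAle nkl.
have llt := page_pos_lt ht (inr (i, l) : V); rewrite /= in llt.
have -> : (inr (i, k) : V) != inr (i, l) by apply: contraNneq nkl => -[->].
rewrite /=; transitivity (cycle_adj t k.+2 l.+2).
  by apply/existsP/idP => [[p /and3P[]]|] //; exists i; rewrite eqxx.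
by rewrite cycle_adjE ?llt ?andbT // orbF.
Qed.

Lemma gram_hub_page_neq0 (a : 'I_2) i (k : 'I_(t - 2)) :
  (gram (inl a) (inr (i, k)) != 0) = book_adj (inl a : V) (inr (i, k)).
Proof.
rewrite gramC gram_page book_adj_hub_page /=.
case: ifP => _; last first.
  by rewrite mulr0 addr0 pnatr_eq0 eqb0 negbK.
have klt := ltn_ord k; have -> : (k.+3 == t) = ~~ (k.+1 < t - 2)%N.
  by rewrite -leqNgt leq_subLR eqn_leq add2n; rewrite ltn_subRL in klt; rewrite klt.
(* On the last vertex a single sign remains; elsewhere two consecutive signs of hub 0 cancel. *)
case: (k.+1 < t - 2)%N; last by rewrite mul0r addr0 signr_eq0.
by rewrite mul1r exprS mulN1r subrr eqxx.
Qed.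

(** Different pages have disjoint supports; on one page, distinct vertices share a basis vector
    exactly when they are consecutive, and nonnegative coordinates exclude cancellation. *)
Lemma gram_page_neq0 i j (k l : 'I_(t - 2)) : (i, k) != (j, l) ->
  (gram (inr (i, k)) (inr (j, l)) != 0) = book_adj (inr (i, k) : V) (inr (j, l)).
Proof.
rewrite gram_page book_adj_page /=; case: (eqVneq i j) => [<-|]; last first.
  by rewrite !mul0r mulr0 addr0 eqxx.
rewrite !mul1r /= xpair_eqE eqxx -val_eqE /= eqSS => /negPf ->.
rewrite add0r addr0 [k.+1 == l :> nat]eq_sym.
have [<-|_] := eqVneq (l : nat) k.+1.
  by rewrite ltn_ord mul1r -natrD pnatr_eq0 addn1.
by rewrite mulr0 addr0 pnatr_eq0 eqb0 negbK.
Qed.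

Lemma gram_neq0 u v : u != v -> (gram u v != 0) = adj (s := book m t) u v.
Proof.
case: u v => [a|[i k]] [b|[j l]] uv.
- have m_neq0 : m%:R != 0 :> F by rewrite pnatr_eq0 -lt0n ltnW.
  have adj01 : adj (s := book m t) (inl ord0) (inl ord_max).
    rewrite /= /book_adj /=; apply/existsP; exists (Ordinal (ltnW hm)).
    by rewrite /= /cycle_adj modn_small // ltnW.
  have ord2 (c : 'I_2) : c = ord0 \/ c = ord_max.
    by case: c => -[|[|//]] c2; [left|right]; apply: val_inj.
  case: (ord2 a) (ord2 b) uv => -> [] -> uv; rewrite ?eqxx // in uv.
    by rewrite gram_hubs m_neq0 adj01.
  by rewrite gramC adj_sym gram_hubs m_neq0 adj01.
- exact: gram_hub_page_neq0.
- by rewrite gramC gram_hub_page_neq0 adj_sym.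
- exact: gram_page_neq0.
Qed.

Definition gram_vectors : 'M[F]_(#|{: 'I_m * 'I_(t - 2)}|, #|vertex (book m t)|) :=
  \matrix_(p, j)
    let: (i, l) := (enum_val p : 'I_m * 'I_(t - 2)) in gram_coord i l (enum_val j).

Definition book_mx : 'M[F]_#|vertex (book m t)| := gram_vectors^T *m gram_vectors.

Lemma book_mxE i j : book_mx i j = gram (enum_val i) (enum_val j).
Proof.
rewrite mxE /gram pair_big /=.
rewrite [RHS](reindex _ (onW_bij _ (enum_val_bij ('I_m * 'I_(t - 2))%type))) /=.
by apply: eq_bigr => p _; rewrite !mxE; case: (enum_val p).
Qed.

Lemma book_mx_graph : matrix_graph_is book_mx.
Proof.
move=> i j ij; rewrite book_mxE gram_neq0 // (inj_eq enum_val_inj).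
by apply: contraTneq ij => ->; rewrite ltnn.
Qed.

Lemma book_mx_psd : psdmx theta book_mx.
Proof.
have VE : map_mx theta gram_vectors = gram_vectors.
  apply/matrixP => p j; rewrite !mxE; case: (enum_val p) => i l; rewrite /gram_coord.
  case: (enum_val j) => [a|[i' k]]; last by rewrite rmorphM rmorphD !rmorph_nat.
  by case: ifP => _; rewrite ?rmorph_sign ?rmorph_nat.
have AE : book_mx = adjmx theta gram_vectors *m gram_vectors.
  by rewrite /adjmx -map_trmx VE.
split=> [|x].
  by rewrite /adjmx -map_trmx map_mxM -map_trmx VE trmx_mul trmxK.
rewrite AE mulmxA -mulmxA.
have -> : adjmx theta x *m adjmx theta gram_vectors = adjmx theta (gram_vectors *m x).
  by rewrite /adjmx trmx_mul map_mxM.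
by rewrite adjmx_mul_self sumr_ge0.
Qed.

Lemma nullity_book_mx : (2 <= nullity book_mx)%N.
Proof.
have rank_le : (\rank book_mx <= m * (t - 2))%N.
  apply: leq_trans (mxrankM_maxr _ _) (leq_trans (rank_leq_row _) _).
  by rewrite card_prod !card_ord.
have card_book : #|vertex (book m t)| = (2 + m * (t - 2))%N.
  by rewrite card_sum card_prod !card_ord.
rewrite /nullity mxrank_coker [X in (X - _)%N]card_book.
by rewrite -addnBA // leq_addr.
Qed.

End BookGram.

(** * Equality of the three parameters *)

Lemma M_plus_bounds (F : numFieldType) (theta : {rmorphism F -> F}) (m t : nat)
    (P : 'M[F]_#|vertex (book m t)| -> Prop) :
  (forall a : F, 0 <= a -> theta a = a) -> (forall a : F, 0 <= theta a * a) ->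
  (forall A, P A <-> psdmx theta A) -> (2 <= m)%N -> (3 <= t)%N ->
  max_nullity (fun A => P A /\ matrix_graph_is A) = 2%N /\
  Z_plus (book m t) = 2%N.
Proof.
move=> thetaid theta_ge0 PE hm ht.
have hubsF := hubs_forcing m ht.
have [Apsd Agr] := (book_mx_psd m t theta_ge0, book_mx_graph hm ht F).
have le2 := nullity_book_mx.
split; apply/eqP; rewrite eqn_leq; apply/andP; split.
- apply: max_nullity_leq => A [/PE AP AG]; rewrite -(card_hubs m t).
  exact: (nullity_le_psd_zero_forcing thetaid theta_ge0 AP AG hubsF).
- by apply: leq_trans (leq_max_nullity _); [exact: le2|split; [apply/PE; exact: Apsd|exact: Agr]].
- by rewrite -(card_hubs m t) Z_plus_leq.
(* The nullity of [book_mx] is at least 2 and at most the size of any forcing set. *)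
- apply: leq_Z_plus => X XF; apply: leq_trans (le2 m t F) _.
  exact: (nullity_le_psd_zero_forcing thetaid theta_ge0 Apsd Agr XF).
Qed.

Local Close Scope ring_scope.

Theorem proposition3p11 (R : realType) (m t : nat) (hm : 2 <= m) (ht : 3 <= t) :
  [/\ M_plus_real R (book m t) = 2,
      M_plus_complex R (book m t) = 2
    & Z_plus (book m t) = 2].
Proof.
have [MR Z] : M_plus_real R (book m t) = 2 /\ Z_plus (book m t) = 2.
  apply: (@M_plus_bounds R idfun) => //; last exact: real_psd_psdmx.
  by move=> a /=; rewrite -expr2 sqr_ge0.
have [MC _] : M_plus_complex R (book m t) = 2 /\ Z_plus (book m t) = 2.
  apply: (@M_plus_bounds R[i] Num.conj) => //; last exact: complex_psd_psdmx.
    exact: geC0_conj.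
  by move=> a; rewrite mulrC mul_conjC_ge0.
by split.
Qed.
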